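(* Let $\mathbb{F}_q$ be a finite field. For every integer $l\geqslant 3$, there exist integers $n\geqslant l$ and $k\geqslant 1$ and a set of vectors $\mathcal{V}\subseteq \mathbb{N}^n$ such that $\mathcal{V}$ satisfies property $V_l(k)$, but the polynomials in $P(k,\mathcal{V})$ are linearly dependent over $\mathbb{F}_q(x_1,\dots,x_n)$.
   Context: $\mathbb{N}=\{0,1,2,\dots\}$ and $[n]:=\{1,\dots,n\}$. $\mathbb{F}_q(x_1,\dots,x_n)$ is the field of rational functions in the formal variables $x_1,\dots,x_n$ over $\mathbb{F}_q$, and $x$ is a further formal variable. For $\mathbf{v}\in\mathbb{N}^n$, $\mathbf{v}(i)$ is its $i$-th coordinate and $|\mathbf{v}|:=\sum_{i=1}^n\mathbf{v}(i)$. For $\mathcal{V}=\{\mathbf{v}_1,\dots,\mathbf{v}_m\}\subseteq\mathbb{N}^n$ and nonempty $I\subseteq[m]$, let $\mu_{\mathcal{V}}(I)=(\min_{i\in I}\mathbf{v}_i(1),\dots,\min_{i\in I}\mathbf{v}_i(n))$. For integers $k,m,n\geqslant 1$ and $0\leqslant l\leqslant n$, $\mathcal{V}=\{\mathbf{v}_1,\dots,\mathbf{v}_m\}\subseteq\mathbb{N}^n$ satisfies property $V_l(k)$ if: (I) $|\mathbf{v}_i|\leqslant k-1$ for all $i\in[m]$; (II) for all nonempty $I\subseteq[m]$, $\sum_{i\in I}(k-|\mathbf{v}_i|)+|\mu_{\mathcal{V}}(I)|\leqslant k$; (III) $\mathbf{v}_i\in\{0,1\}^{n-l}\times\mathbb{N}^l$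 for all $i\in[m]$. For $k>|\mathbf{v}|$, $P(k,\mathbf{v}):=\left\{\prod_{j\in[n]}(x-x_j)^{\mathbf{v}(j)}x^e : e=0,\dots,k-1-|\mathbf{v}|\right\}\subseteq \mathbb{F}_q(x_1,\dots,x_n)[x]$, and $P(k,\mathcal{V})=P(k,\mathbf{v}_1)\cup\dots\cup P(k,\mathbf{v}_m)$, understood as a multiset union (so $|P(k,\mathcal{V})|=\sum_i|P(k,\mathbf{v}_i)|$). *)

(* Defs.v *)
From HB Require Import structures.
From mathcomp Require Import all_boot all_algebra.
From mathcomp Require Import mpoly.

Set Implicit Arguments.
Unset Strict Implicit.
Unset Printing Implicit Defensive.

Import GRing.Theory.

(* A vector of N^n is an element of 'X_{1..n}, and |v| is mdeg v.
   A set {v_1, ..., v_m} is an injective family V : 'I_m -> 'X_{1..n}.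
   Indices are 0-based throughout. *)

Local Open Scope nat_scope.

(* nat has no neutral element for minn, so the iteration starts from the
   maximum, which leaves the minimum unchanged when I is nonempty: see
   vmin_le and vmin_attained. *)
Definition vmin (n m : nat) (V : 'I_m -> 'X_{1..n}) (I : {set 'I_m}) :
    'X_{1..n} :=
  [multinom \big[minn/(\max_(i in I) V i j)]_(i in I) V i j | j < n].

Lemma vmin_le (n m : nat) (V : 'I_m -> 'X_{1..n}) (I : {set 'I_m})
    (i : 'I_m) (j : 'I_n) : i \in I -> vmin V I j <= V i j.
Proof.
move=> Ii; rewrite mnmE; move: (\max_(_ in _) _) => z.
have := mem_index_enum i.
elim: (index_enum _) => // a s IHs; rewrite inE big_cons.
case/predU1P=> [<-|/IHs les]; first by rewrite Ii geq_minl.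
by case: ifP => // _; rewrite geq_min les orbT.
Qed.

Lemma vmin_attained (n m : nat) (V : 'I_m -> 'X_{1..n}) (I : {set 'I_m})
    (j : 'I_n) : I != set0 -> exists2 i, i \in I & vmin V I j = V i j.
Proof.
case/set0Pn=> i0 Ii0; rewrite mnmE.
apply: (big_ind (fun x => exists2 i, i \in I & x = V i j)).
- have [|i Ii ->] := @eq_bigmax_cond _ (mem I) (fun i => V i j).
    by apply/card_gt0P; exists i0.
  by exists i.
- by move=> x y [a Ia ->] [b Ib ->]; case: leqP => _; [exists a | exists b].
- by move=> i Ii; exists i.
Qed.

Definition propV (l k n m : nat) (V : 'I_m -> 'X_{1..n}) : Prop :=
  [/\ forall i : 'I_m, mdeg (V i) <= k - 1,
      forall I : {set 'I_m}, I != set0 ->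
        \sum_(i in I) (k - mdeg (V i)) + mdeg (vmin V I) <= k
    & forall (i : 'I_m) (j : 'I_n), j < n - l -> V i j <= 1].

Local Open Scope ring_scope.

Definition ratfun (F : finFieldType) (n : nat) : fieldType :=
  {fraction {mpoly F[n]}}.

Definition ratvar (F : finFieldType) (n : nat) (j : 'I_n) : ratfun F n :=
  tofrac (mpolyX F (mnm1 j)).

Definition Pvec (F : finFieldType) (n k : nat) (v : 'X_{1..n}) :
    seq {poly ratfun F n} :=
  [seq (\prod_(j < n) ('X - (ratvar F j)%:P) ^+ v j) * 'X^e
    | e <- iota 0 (k - mdeg v)].

(* The multiset union P(k, V), as a list. *)
Definition Pfam (F : finFieldType) (n m k : nat) (V : 'I_m -> 'X_{1..n}) :
    seq {poly ratfun F n} :=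
  flatten [seq Pvec F k (V i) | i <- enum 'I_m].

(* Stated for a list, with multiplicity: a repeated entry is a dependency.
   The library's free requires a finite-dimensional space, which {poly K}
   is not. *)
Definition lindep (K : fieldType) (W : lmodType K) (s : seq W) : Prop :=
  exists c : 'I_(size s) -> K,
    (exists i, c i != 0) /\ \sum_(i < size s) c i *: s`_i = 0.

(* Main.v *)
Require Import Defs.
From mathcomp Require Import all_boot all_algebra.
From mathcomp Require Import mpoly.
From mathcomp Require Import zify ring.

(** Take k = 4 and the exponent vectors of X^3, Y^3, Z^3 and XYZ, where
    X, Y, Z stand for x - x_1, x - x_2, x - x_3 (padded with zeros to length l).
    Each of the four blocks P(4, v) is a single cubic.  The linear forms satisfy
    aX + bY + cZ = 0 with a = x_2 - x_3, b = x_3 - x_1, c = x_1 - x_2, and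
    A + B + C = 0 implies A^3 + B^3 + C^3 = 3ABC.  This is a dependency in every
    characteristic, since the coefficient a^3 is nonzero. *)

Set Implicit Arguments.
Unset Strict Implicit.
Unset Printing Implicit Defensive.

Import GRing.Theory.

Local Open Scope ring_scope.

(** The coefficient at the monomial [U_(j)] tells the variables apart. This is what makes x_2 - x_3
    nonzero. *)
Lemma ratvar_inj (F : finFieldType) (n : nat) : injective (@ratvar F n).
Proof.
move=> i j /eqP; rewrite tofrac_eq => /eqP /(congr1 (mcoeff U_(j)%MM)).
by rewrite !mcoeffXU eqxx; case: eqP => // _ /eqP; rewrite eq_sym oner_eq0.
Qed.

Definition cubicV (n : nat) (i : 'I_4) : 'X_{1..n} :=
  [multinom (if (i < 3)%N then (i == j :> nat) * 3 else (j < 3)%N)%N | j < n].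

Lemma cubicV_ge3 (n : nat) (i : 'I_4) (j : 'I_n) :
  (3 <= j)%N -> cubicV n i j = 0%N.
Proof. by rewrite mnmE; case: i => [] [|[|[|[|]]]] //= _; lia. Qed.

Lemma big_ord_recl3 (R : Type) (idx : R) (op : Monoid.law idx) (n : nat)
    (f : 'I_n.+3 -> R) :
  \big[op/idx]_j f j = op (f (inord 0)) (op (f (inord 1))
    (op (f (inord 2)) (\big[op/idx]_(j < n) f (inord j.+3)))).
Proof.
rewrite 3!big_ord_recl.
congr (op (f _) (op (f _) (op (f _) _))); try by apply: val_inj; rewrite /= inordK.
apply: eq_bigr => j _; congr f; apply: val_inj.
by rewrite /= inordK ?ltnS ?ltn_ord.
Qed.

Lemma big_ord_first3 (R : Type) (idx : R) (op : Monoid.law idx) (n : nat)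
    (f : 'I_n.+3 -> R) :
  (forall j : 'I_n.+3, (3 <= j)%N -> f j = idx) ->
  \big[op/idx]_j f j = op (f (inord 0)) (op (f (inord 1)) (f (inord 2))).
Proof.
move=> f0; rewrite big_ord_recl3 big1 ?Monoid.mulm1 // => j _.
by apply: f0; rewrite inordK ?ltnS ?ltn_ord.
Qed.

Lemma mdeg_cubicV (n : nat) (i : 'I_4) : mdeg (cubicV n.+3 i) = 3%N.
Proof.
rewrite mdegE big_ord_first3; last by move=> j; apply: cubicV_ge3.
by rewrite !mnmE !inordK //; case: i => [] [|[|[|[|]]]].
Qed.

Lemma cubicV_inj (n : nat) : injective (cubicV n.+3).
Proof.
move=> i i' /mnmP eqV.
have := eqV (inord 2); have := eqV (inord 1); have := eqV (inord 0).
rewrite !mnmE !inordK // => e0 e1 e2; apply: val_inj => /=.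
by move: e0 e1 e2; case: i i' {eqV} => [] [|[|[|[|]]]] //= ? [] [|[|[|[|]]]].
Qed.

(** Condition (III) holds because the length is [l], so no index lies below n - l = 0. In (II) each
    vector contributes 4 - 3 = 1: a singleton gives 1 + 3, a cube together with XYZ gives 2 + 1, and
    any other [I] contains two cubes, so its minimum is zero while |I| is at most 4. *)
Lemma propV_cubicV (n : nat) : propV n.+3 4 (cubicV n.+3).
Proof.
split=> [i|I I0|i j]; [by rewrite mdeg_cubicV | | by rewrite subnn].
under eq_bigr do rewrite mdeg_cubicV.
(* The cardinality of [I] becomes a sum of four membership indicators. *)
rewrite sum1_card -sum1_card big_mkcond big_ord_recl3 big_ord1 /=.
rewrite mdegE big_ord_first3; last first.
  move=> j lej; have [i Ii ->] := vmin_attained (cubicV n.+3) j I0.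
  exact: cubicV_ge3.
have {I0} [i1 Ii1] := set0Pn _ I0.
have := fun i Ii => (@vmin_le _ _ (cubicV n.+3) I i (inord 0) Ii,
  @vmin_le _ _ (cubicV n.+3) I i (inord 1) Ii,
  @vmin_le _ _ (cubicV n.+3) I i (inord 2) Ii).
move: (vmin _ _ _) (vmin _ _ _) (vmin _ _ _) => a b c le.
(* The bounds [le] on [a], [b], [c] say nothing for an empty [I], so nonemptiness is recorded as a
   disjunction before the case split on the four memberships. *)
have some : [|| inord 0 \in I, inord 1 \in I, inord 2 \in I | inord 3 \in I].
  rewrite -[i1]inord_val in Ii1.
  by case: (i1) Ii1 => [] [|[|[|[|]]]] //= _ ->; rewrite ?orbT.
have := (le (inord 0), le (inord 1), le (inord 2), le (inord 3)).
rewrite !mnmE !inordK //= {le} => -[[[]]].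
move: some; do 4!case: (inord _ \in I); move=> // _;
  do 4![move=> /(_ isT)[[? ?] ?] | move=> _]; lia.
Qed.

Lemma prod_cubicV (R : comNzRingType) (n : nat) (f : 'I_n.+3 -> R) (i : 'I_4) :
  \prod_j f j ^+ cubicV n.+3 i j =
    if (i < 3)%N then f (inord i) ^+ 3
    else f (inord 0) * f (inord 1) * f (inord 2).
Proof.
rewrite big_ord_first3 => [|j lej]; last by rewrite cubicV_ge3.
rewrite !mnmE !inordK //=.
by case: i => [] [|[|[|[|]]]] //= _; rewrite ?expr0 ?expr1 ?mulr1 ?mul1r ?mulrA.
Qed.

Lemma Pvec_cubicV (F : finFieldType) (n : nat) (i : 'I_4) :
  let L j : {poly ratfun F n.+3} := 'X - (ratvar F (inord j))%:P in
  Pvec F 4 (cubicV n.+3 i) =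
    [:: if (i < 3)%N then L i ^+ 3 else L 0%N * L 1%N * L 2%N].
Proof. by rewrite /Pvec mdeg_cubicV /= expr0 mulr1 prod_cubicV. Qed.

(** Here A = (y - z)(t - x), and B, C are its cyclic shifts. The factors stay apart so that, at t =
    ['X], each term is a constant times a member of the family. *)
Lemma cubic_relation (R : comNzRingType) (x y z t : R) :
  (y - z) ^+ 3 * (t - x) ^+ 3 + (z - x) ^+ 3 * (t - y) ^+ 3
    + (x - y) ^+ 3 * (t - z) ^+ 3
    - 3%:R * (y - z) * (z - x) * (x - y) * ((t - x) * (t - y) * (t - z)) = 0.
Proof. by ring. Qed.

Lemma lindep_cubicV (F : finFieldType) (n : nat) :
  lindep (Pfam F 4 (cubicV n.+3)).
Proof.
pose v j := ratvar F (inord j : 'I_n.+3).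
pose L j : {poly ratfun F n.+3} := 'X - (v j)%:P.
have -> : Pfam F 4 (cubicV n.+3) =
    [:: L 0%N ^+ 3; L 1%N ^+ 3; L 2%N ^+ 3; L 0%N * L 1%N * L 2%N].
  by rewrite /Pfam (eq_map (@Pvec_cubicV F n)) !enum_ordSl enum_ord0.
pose a := v 1%N - v 2%N; pose b := v 2%N - v 0%N; pose c := v 0%N - v 1%N.
exists (fun i => [:: a ^+ 3; b ^+ 3; c ^+ 3; - (3%:R * a * b * c)]`_i); split.
  (* The first coefficient is used since the last one vanishes in characteristic 3. *)
  exists ord0 => /=; rewrite expf_neq0 // subr_eq0.
  apply/eqP => /ratvar_inj /(congr1 val) /=.
  by rewrite !inordK.
(* Scalars become constant polynomials, which turns the goal into an identity in the polynomial
   ring. *)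
rewrite !big_ord_recl big_ord0 /= addr0 !addrA -!mul_polyC.
rewrite !(polyCN, polyCM, polyCB, rmorphXn) /= mulNr.
rewrite -[RHS](cubic_relation (v 0%N)%:P (v 1%N)%:P (v 2%N)%:P 'X).
by rewrite !(polyCB, polyCMn).
Qed.

Theorem mainTheorem3 (F : finFieldType) (l : nat) (hl : (3 <= l)%N) :
  exists (n k m : nat) (V : 'I_m -> 'X_{1..n}),
    [/\ (l <= n)%N, (1 <= k)%N, (1 <= m)%N & injective V] /\
    propV l k V /\ lindep (Pfam F k V).
Proof.
case: l hl => [|[|[|n]]] // _; exists n.+3, 4, 4, (cubicV n.+3).
split; first by split=> //; apply: cubicV_inj.
by split; [apply: propV_cubicV | apply: lindep_cubicV].
Qed.
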